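(* Let $\gamma\in(0,1)$, $\delta\in(0,1)$. In the nonstationary generalized linear bandit described in the context, for every fixed $t\ge2$, with probability at least $1-\delta$, $$\sum_{s=1}^{t-1}\gamma^{t-1-s}\left(\ell_s(\theta_t^\star)-\ell_s(\theta_s^\star)\right)\le\frac{k_\mu}{g(\tau)}\,\mathcal V_t^2+\frac{R^2}{4\,g(\tau)\,k_\mu}\log\frac1\delta,$$ where $$\mathcal V_t=\sum_{p=1}^{t-1}\gamma^{(t-1-p)/2}\sqrt{\frac{1-\gamma^p}{1-\gamma}}\;\|\theta_{p+1}^\star-\theta_p^\star\|_2 .$$
   Context: Nonstationary generalized linear bandit. Fix $d\ge1$, $R,S>0$. At each round $t=1,2,\dots$ a learner observes a set $\mathcal X_t\subset\mathbb R^d$, chooses $x_t\in\mathcal X_t$ (based on the past), and receives a reward $r_t$. There is an unknown parameter sequence $(\theta_t^\star)_{t\ge1}$ in $\mathbb R^d$, fixed independently of the reward noise (exogenous/oblivious). Let $p(r\mid z)=\exp\left(\frac{rz-m(z)}{g(\tau)}+h(r,\tau)\right)$ be a probability density in $r$ (with respect to a fixed reference measure), where $m:\mathbb R\to\mathbb R$ is convex and three times continuously differentiable and $g(\tau)>0$ is a known constant. Put $\mu:=m'$. With $\widetilde{\mathcal F}_t:=\sigma(x_1,r_1,\dots,x_{t-1},r_{t-1},x_t)\vee\sigma(\theta_s^\star:s\ge1)$, the conditional law of $r_t$ given $\widetilde{\mathcal F}_t$ has density $p(\cdot\mid x_t^\top\theta_t^\star)$; in particular its conditional mean is $\mu(x_t^\top\theta_t^\star)$.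 Assumptions. For all $t$: $\|\theta_t^\star\|_2\le S$, $\|x\|_2\le1$ for all $x\in\mathcal X_t$, $r_t\in[0,R]$ almost surely. There are constants $c_\mu,k_\mu>0$ with $c_\mu\le\mu'(z)\le k_\mu$ for all $z\in[-S,S]$. Loss: $\ell_t(\theta):=\frac{m(x_t^\top\theta)-r_tx_t^\top\theta}{g(\tau)}$. *)

(* Defs.v *)
From HB Require Import structures.
From mathcomp Require Import all_boot all_order all_algebra.
From mathcomp Require Import all_classical all_reals all_analysis measurable_realfun.

Set Implicit Arguments.
Unset Strict Implicit.
Unset Printing Implicit Defensive.

Import Order.TTheory GRing.Theory Num.Theory.
Import numFieldNormedType.Exports.

Local Open Scope classical_set_scope.
Local Open Scope ring_scope.

Definition dot (R : realType) (d : nat) (u v : 'rV[R]_d) : R :=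
  \sum_(i < d) u 0 i * v 0 i.

(* The Euclidean norm: the norm `|v| that MathComp-Analysis puts on 'rV[R]_d
   is the max norm. *)
Definition norm2 (R : realType) (d : nat) (v : 'rV[R]_d) : R :=
  Num.sqrt (\sum_(i < d) v 0 i ^+ 2).

Definition random_vector (R : realType) (disp : measure_display)
    (Omega : measurableType disp) (d : nat) (v : Omega -> 'rV[R]_d) : Prop :=
  forall i : 'I_d, measurable_fun setT (fun w => v w 0 i).

Definition contdiff (R : realType) (n : nat) (f : R -> R) : Prop :=
  (forall k, (k < n)%N -> forall z, derivable (derive1n k f) z 1) /\
  continuous (derive1n n f).

Definition mean_function (R : realType) (m : R -> R) : R -> R := derive1 m.

Definition glm_density (R : realType) (m g : R -> R) (h : R -> R -> R)
    (tau y z : R) : R :=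
  expR ((y * z - m z) / g tau + h y tau).

Definition is_prob_density (R : realType)
    (nu : {measure set R -> \bar R}) (f : R -> R) : Prop :=
  [/\ measurable_fun setT f,
      forall y, 0 <= f y &
      (\int[nu]_y (f y)%:E = 1)%E].

Definition sigma_vec (R : realType) (disp : measure_display)
    (Omega : measurableType disp) (d : nat) (v : Omega -> 'rV[R]_d) :
    set (set Omega) :=
  <<s \bigcup_(i in [set: 'I_d])
        g_sigma_algebra_preimage (fun w => v w 0 i) >>.

(* sigma(x_1, r_1, ..., x_(t-1), r_(t-1), x_t) \/ sigma(theta_s : s >= 1).
   Rounds are numbered from 1; the values at index 0 are never used. *)
Definition history (R : realType) (disp : measure_display)
    (Omega : measurableType disp) (d : nat)
    (x theta : nat -> Omega -> 'rV[R]_d) (r : nat -> Omega -> R) (t : nat) :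
    set (set Omega) :=
  <<s (\bigcup_(s in [set s | (1 <= s <= t)%N]) sigma_vec (x s)) `|`
      (\bigcup_(s in [set s | (1 <= s < t)%N]) g_sigma_algebra_preimage (r s)) `|`
      (\bigcup_(s in [set s | (1 <= s)%N]) sigma_vec (theta s)) >>.

(* The conditional law of Y given the sub-sigma-algebra F has the (random)
   density q w with respect to nu: for every Borel set B, the variable
   w |-> \int_B q w d(nu) is a version of P(Y \in B | F), i.e. it is
   F-measurable and integrates correctly over every A in F. *)
Definition has_cond_density (R : realType) (disp : measure_display)
    (Omega : measurableType disp) (P : probability Omega R)
    (F : set (set Omega)) (Y : Omega -> R)
    (nu : {measure set R -> \bar R})
    (q : Omega -> R -> R) : Prop :=
  forall B : set R, measurable B ->
    (forall C : set (\bar R), measurable C ->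
       F ((fun w => (\int[nu]_(y in B) (q w y)%:E)%E) @^-1` C)) /\
    (forall A : set Omega, F A ->
       P (A `&` Y @^-1` B) =
       (\int[P]_(w in A) \int[nu]_(y in B) (q w y)%:E)%E).

Definition loss (R : realType) (d : nat) (m g : R -> R) (tau : R)
    (x : 'rV[R]_d) (r : R) (theta : 'rV[R]_d) : R :=
  (m (dot x theta) - r * dot x theta) / g tau.

Definition discounted_variation (R : realType) (d : nat) (gamma : R)
    (theta : nat -> 'rV[R]_d) (t : nat) : R :=
  \sum_(1 <= p < t)
     gamma `^ ((t - 1 - p)%N%:R / 2) *
     Num.sqrt ((1 - gamma ^+ p) / (1 - gamma)) *
     norm2 (theta p.+1 - theta p).

(* Main.v *)
(* Put z_s = x_s . theta_s, Delta_s = x_s . (theta_t - theta_s) and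
   w_s = gamma^(t-1-s), and split
     l_s(theta_t) - l_s(theta_s)
       = [m(z_s + Delta_s) - m(z_s) - mu(z_s) Delta_s] / g
         - (r_s - mu(z_s)) Delta_s / g.
   By Taylor the first bracket is at most k_mu Delta_s^2 / 2. For the second
   part, the conditional moment generating function of r_s is explicit,
     E exp(a r_s) = exp((m(z_s + a g) - m(z_s)) / g),
   and Hoeffding's lemma bounds it since r_s lies in [0, R]; hence
     exp(sum_s a_s (r_s - mu(z_s)) - a_s^2 R^2 / 8)
   has expectation at most 1 for predictable a_s. Taking
   a_s = - 4 k_mu w_s Delta_s / R^2, Markov's inequality and w_s^2 <= w_s bound
   the discounted sum by (k_mu / g) sum_s w_s Delta_s^2 plus the deviation term,
   and sum_s w_s Delta_s^2 <= V_t^2 by Minkowski's inequality applied to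
   |Delta_s| <= sum_(s <= p < t) |theta_(p+1) - theta_p|. *)
Require Import Defs.
From HB Require Import structures.
From mathcomp Require Import all_boot all_order all_algebra.
From mathcomp Require Import all_classical all_reals all_analysis measurable_realfun.
From mathcomp Require Import ring lra zify.

Set Implicit Arguments.
Unset Strict Implicit.
Unset Printing Implicit Defensive.

Import Order.TTheory GRing.Theory Num.Theory.
Import numFieldNormedType.Exports.

Local Open Scope classical_set_scope.
Local Open Scope ring_scope.

(** * One-variable calculus: mean values, Taylor, Bernoulli variables *)

(** Writing the intermediate point as a convex combination gives one formula for [a < b], [b < a]
    and [a = b]. *)
Lemma mean_value_convex (R : realType) (f f' : R -> R) (a b : R) :
    (forall u : R, is_derive u 1 f (f' u)) ->
  exists2 k, 0 <= k <= 1 & f b - f a = f' (a + k * (b - a)) * (b - a).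
Proof.
move=> df.
have cf : continuous f.
  by move=> u; apply/differentiable_continuous/derivable1_diffP.
have [ab|ba|->] := ltgtP a b.
- have [c cab ->] := MVT ab (fun u _ => df u) (continuous_subspaceT cf).
  have ba0 : 0 < b - a by rewrite subr_gt0.
  exists ((c - a) / (b - a)); last by rewrite divfK ?gt_eqF// [a + _]addrC subrK.
  move: cab; rewrite in_itv/= => /andP[ac cb].
  rewrite divr_ge0 ?ler_pdivrMr ?mul1r//; lra.
- have [c cab fab] := MVT ba (fun u _ => df u) (continuous_subspaceT cf).
  have ab0 : 0 < a - b by rewrite subr_gt0.
  exists ((a - c) / (a - b)).
    move: cab; rewrite in_itv/= => /andP[ac cb].
    rewrite divr_ge0 ?ler_pdivrMr ?mul1r//; lra.
  have -> : a + (a - c) / (a - b) * (b - a) = c by field; lra.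
  lra.
- by exists 0; rewrite ?lexx ?ler01// !subrr mulr0.
Qed.

(** Let [G] be the quadratic majorant minus [f]. The mean value theorem for [G], then for [f'],
    yields [G y - G z = (K - f'' xi) * k * (y - z) ^+ 2] with [k >= 0] and [xi] between [z] and [y],
    so [f''] needs a bound on that segment only. *)
Lemma taylor2_upper_bound (R : realType) (f f' f'' : R -> R) (K z y : R) :
    (forall u : R, is_derive u 1 f (f' u)) -> (forall u : R, is_derive u 1 f' (f'' u)) ->
    (forall k, 0 <= k <= 1 -> f'' (z + k * (y - z)) <= K) ->
  f y - f z - f' z * (y - z) <= K / 2 * (y - z) ^+ 2.
Proof.
move=> df df' f''K.
pose G u := K / 2 * (u - z) ^+ 2 + f' z * (u - z) - f u.
have dG (u : R) : is_derive u 1 G (K * (u - z) + f' z - f' u).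
  rewrite /G; apply: is_derive_eq; rewrite /GRing.scale/=; lra.
have [k k01 Gk] := mean_value_convex z y dG.
have [l l01 f'l] := mean_value_convex z (z + k * (y - z)) df'.
suff : 0 <= G y - G z by rewrite /G; lra.
have K0 : 0 <= K - f'' (z + (l * k) * (y - z)).
  rewrite subr_ge0; apply: f''K.
  case/andP: k01 => k0 k1; case/andP: l01 => l0 l1.
  by rewrite mulr_ge0//= mulr_ile1.
have zk : z + k * (y - z) - z = k * (y - z) by ring.
move: f'l; rewrite zk mulrA => f'l.
have -> : G y - G z = (K - f'' (z + (l * k) * (y - z))) * k * (y - z) ^+ 2.
  rewrite Gk zk.
  have -> : f' (z + k * (y - z)) =
     f' z + f'' (z + l * k * (y - z)) * (k * (y - z)) by lra.
  ring.
by case/andP: k01 => k0 _; rewrite mulr_ge0 ?sqr_ge0// mulr_ge0.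
Qed.

(** The logarithm [L] of the left-hand side satisfies [L 0 = 0], [L' 0 = p] and
    [L'' = L' - L' ^+ 2 <= 1 / 4]; the second-order Taylor bound at 0 gives the constant 1/8. *)
Lemma bernoulli_mgf_le (R : realType) (p u : R) : 0 <= p <= 1 ->
  1 - p + p * expR u <= expR (p * u + u ^+ 2 / 8).
Proof.
move=> /andP[p0 p1].
pose D v : R := 1 - p + p * expR v.
have D0 v : 0 < D v.
  rewrite /D; have [->|pN0] := eqVneq p 0; first by lra.
  have pp : 0 < p by rewrite lt_neqAle eq_sym pN0.
  have := mulr_gt0 pp (expR_gt0 v); lra.
pose L v := ln (D v).
pose L1 v := p * expR v / D v.
have dD (v : R) : is_derive v 1 D (p * expR v).
  by rewrite /D; apply: is_derive_eq; rewrite /GRing.scale/=; lra.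
have dL (v : R) : is_derive v 1 L (L1 v).
  have dl := is_derive1_ln (D0 v).
  apply: (is_derive_eq (is_derive1_comp dl (dD v))).
  by rewrite /L1 mulrC.
have dL1 (v : R) : is_derive v 1 L1 (L1 v - L1 v ^+ 2).
  have DN0 : D v != 0 by rewrite gt_eqF.
  rewrite /L1; apply: is_derive_eq; rewrite /GRing.scale/=; field.
  exact: DN0.
have := @taylor2_upper_bound _ L L1 _ (1 / 4) 0 u dL dL1.
have L0 : L 0 = 0.
  by rewrite /L /D expR0 mulr1 subrK ln1.
have L10 : L1 0 = p by rewrite /L1 /D expR0 mulr1 subrK divr1.
rewrite L0 L10 !subr0 => /(_ _)/wrap[] => [k _|Lu].
  (* The gap [1 / 4 - (L1 - L1 ^+ 2)] is the square of [L1 - 1 / 2]. *)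
  have := sqr_ge0 (L1 (0 + k * u) - 1 / 2); lra.
rewrite -ler_ln ?posrE ?expR_gt0//; last exact: D0.
rewrite expRK -/(D u) -/(L u); lra.
Qed.

(** * Measures given by a density *)

Section density_measure.
Local Open Scope ereal_scope.
Context disp (T : measurableType disp) (R : realType).

(** The proofs [mf] and [f0] are arguments so that the measure structure can be inferred from the
    term itself. *)
Definition density_measure (mu : {measure set T -> \bar R}) (f : T -> R)
    (mf : measurable_fun setT f) (f0 : forall x, (0 <= f x)%R) :
    set T -> \bar R :=
  fun A => \int[mu]_(x in A) (f x)%:E.

Variables (mu : {measure set T -> \bar R}) (f : T -> R).
Hypotheses (mf : measurable_fun setT f) (f0 : forall x, (0 <= f x)%R).

Let nu := density_measure mu mf f0.

Let nu0 : nu set0 = 0.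
Proof. by rewrite /nu /density_measure integral_set0. Qed.

Let nu_ge0 A : 0 <= nu A.
Proof. by apply: integral_ge0 => x _; rewrite lee_fin. Qed.

Let nu_sigma_additive : semi_sigma_additive nu.
Proof.
move=> F mF tF mUF.
rewrite /nu /density_measure ge0_integral_bigcup//.
- by apply: is_cvg_nneseries => n _ _; apply: integral_ge0 => x _; rewrite lee_fin.
- exact/measurable_EFinP/measurable_funTS.
- by move=> x _; rewrite lee_fin.
Qed.

HB.instance Definition _ := isMeasure.Build _ _ _
  (density_measure mu mf f0) nu0 nu_ge0 nu_sigma_additive.

Import HBNNSimple.

(** On indicators the identity is the definition of the measure; simple functions follow by
    linearity, and monotone convergence passes to the limit on both sides. *)
Lemma ge0_integral_density_measure (g : T -> \bar R) :
    measurable_fun setT g -> (forall x, 0 <= g x) ->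
  \int[density_measure mu mf f0]_x g x = \int[mu]_x (g x * (f x)%:E).
Proof.
move=> mg g0; pose g_ := nnsfun_approx measurableT mg.
have mgf n : measurable_fun setT (fun x => (g_ n x)%:E * (f x)%:E).
  by apply: emeasurable_funM; exact/measurable_EFinP.
transitivity (limn (fun n => \int[density_measure mu mf f0]_x (g_ n x)%:E)).
  rewrite -monotone_convergence//.
  - apply: eq_integral => x _; apply/esym/cvg_lim => //.
    exact: cvg_nnsfun_approx.
  - by move=> n; exact/measurable_EFinP.
  - by move=> n x _; rewrite lee_fin.
  - by move=> x _ m n mn; rewrite lee_fin; exact/lefP/nd_nnsfun_approx.
transitivity (limn (fun n => \int[mu]_x ((g_ n x)%:E * (f x)%:E))); last first.
  rewrite -monotone_convergence//.
  - apply: eq_integral => x _; apply/cvg_lim => //.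
    by apply: cvgeZr => //; exact: cvg_nnsfun_approx.
  - by move=> n x _; rewrite mule_ge0// lee_fin.
  - move=> x _ m n mn; apply: lee_wpmul2r; first by rewrite lee_fin.
    by rewrite lee_fin; exact/lefP/nd_nnsfun_approx.
congr (limn _); apply/funext => n.
(* The simple function is split over its finitely many values. *)
transitivity (\sum_(k \in range (g_ n))
    \int[mu]_x (k * \1_(g_ n @^-1` [set k]) x * f x)%:E).
  under eq_integral do rewrite fimfunE -fsumEFin//.
  rewrite ge0_integral_fsum//; last 2 first.
  - by move=> y; exact/measurable_EFinP/measurable_funM.
  - by move=> y x _; rewrite nnfun_muleindic_ge0.
  apply: eq_fsbigr => r; rewrite inE => -[z _ zr].
  rewrite integralZl_indic_nnsfun// integral_indic// setIT.
  have r0 : (0 <= r)%R by rewrite -zr.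
  under [RHS]eq_integral do rewrite -mulrA EFinM.
  rewrite ge0_integralZl//=; last 2 first.
  - by apply/measurable_EFinP/measurable_funM.
  - by move=> x _; rewrite lee_fin mulr_ge0.
  congr (_ * _); rewrite /density_measure integral_mkcond.
  apply: eq_integral => x _; rewrite patchE indicE.
  by case: (x \in _); rewrite ?mul1r ?mul0r.
rewrite -ge0_integral_fsum//.
- apply: eq_integral => x _; rewrite fsumEFin// -EFinM; congr EFin.
  rewrite (fimfunE (g_ n)) mulrC mulr_fsumr//.
  by apply: eq_fsbigr => k _; rewrite mulrC.
- move=> r; apply/measurable_EFinP; apply: measurable_funM => //.
  exact: measurable_funM.
- by move=> r x _; rewrite EFinM mule_ge0// ?nnfun_muleindic_ge0// lee_fin.
Qed.

End density_measure.

(** * Integration against a conditional density *)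

Section conditional_density.
Local Open Scope ereal_scope.
Context disp (Omega : measurableType disp) (R : realType) (P : probability Omega R).
Variables (G : set (set Omega)) (nu : {measure set R -> \bar R}).
(** [Omega] equipped with only the sigma-algebra generated by [G]: joint measurability on
    [OmegaG * R] encodes dependence on the past in the first coordinate. *)
Let OmegaG := g_sigma_algebraType G.
Variables (f0 : R -> R) (k : OmegaG * R -> R).
Hypotheses (GP : <<s G>> `<=` measurable) (f0P : is_prob_density nu f0).
Hypotheses (mk : measurable_fun setT k) (k0 : forall u, (0 <= k u)%R).

(* nu need not be sigma-finite: writing the density as k * f0 moves everything
   to the probability measure f0 nu, for which Tonelli's theorem applies. *)
Lemma ge0_integral_cond_density (Y : {RV P >-> R}) (F : OmegaG * R -> \bar R) :
    has_cond_density P <<s G>> Y nu (fun w y => k (w, y) * f0 y)%R ->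
    measurable_fun setT F -> (forall u, 0 <= F u) ->
  let K w := \int[nu]_y (F (w, y) * (k (w, y) * f0 y)%:E) in
  measurable_fun setT (K : Omega -> \bar R) /\
  \int[P]_w F (w, Y w) = \int[P]_w K w.
Proof.
case: f0P => mf0 f00 f01 YP mF F0.
pose P0 : probability R R := HB.pack (density_measure nu mf0 f00)
  (Measure_isProbability.Build _ _ _ (density_measure nu mf0 f00) f01).
have mid : measurable_fun setT (id : Omega -> OmegaG).
  by move=> _ A mA; rewrite setTI; exact: GP.
pose PG := distribution P (HB.pack (id : Omega -> OmegaG)
  (isMeasurableFun.Build _ _ _ _ _ mid) : {mfun Omega >-> OmegaG}).
have mpair : measurable_fun setT (fun w => (w, Y w) : OmegaG * R).
  by apply: measurable_fun_pair.
(* [mu1] is the joint law of the point of [OmegaG] and [Y]; [mu2] is the law prescribed by the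
   density. The integral identity amounts to their equality. *)
pose mu1 := distribution P (HB.pack (fun w => (w, Y w) : OmegaG * R)
  (isMeasurableFun.Build _ _ _ _ _ mpair) : {mfun Omega >-> (OmegaG * R)%type}).
pose mu2 := density_measure (PG \x P0) mk k0.
have innerE (H : OmegaG * R -> \bar R) w : measurable_fun setT H ->
    (forall u, 0 <= H u) -> \int[P0]_y (H (w, y) * (k (w, y))%:E) =
    \int[nu]_y (H (w, y) * (k (w, y) * f0 y)%:E).
  move=> mH H0.
  have mHk : measurable_fun setT (fun u => H u * (k u)%:E).
    by apply: emeasurable_funM => //; exact/measurable_EFinP.
  have mHkw : measurable_fun setT (fun y => H (w, y) * (k (w, y))%:E).
    by apply: (measurableT_comp mHk); exact: (@pair1_measurable _ _ OmegaG).
  rewrite ge0_integral_density_measure//.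
    by apply: eq_integral => y _; rewrite EFinM muleA.
  by move=> y; rewrite mule_ge0// lee_fin.
have mHk (H : OmegaG * R -> \bar R) : measurable_fun setT H ->
    measurable_fun setT (fun u => H u * (k u)%:E).
  by move=> mH; apply: emeasurable_funM => //; exact/measurable_EFinP.
have mu2E (H : OmegaG * R -> \bar R) : measurable_fun setT H ->
    (forall u, 0 <= H u) -> \int[mu2]_u H u =
    \int[P]_w \int[nu]_y (H (w, y) * (k (w, y) * f0 y)%:E).
  move=> mH H0.
  have Hk0 u : 0 <= H u * (k u)%:E by rewrite mule_ge0// lee_fin.
  rewrite ge0_integral_density_measure// fubini_tonelli1//; last exact: mHk.
  rewrite ge0_integral_pushforward//=; last 2 first.
  - by apply: measurable_fun_fubini_tonelli_F => //; exact: mHk.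
  - by move=> w _; exact: integral_ge0.
  rewrite preimage_setT; apply: eq_integral => w _ /=.
  exact: innerE.
split.
  have mFk : measurable_fun setT (fubini_F P0 (fun u => F u * (k u)%:E)).
    apply: measurable_fun_fubini_tonelli_F; first exact: mHk.
    by move=> u; rewrite mule_ge0// lee_fin.
  have := measurableT_comp mFk mid.
  by apply: eq_measurable_fun => w _; rewrite /= /fubini_F innerE.
transitivity (\int[mu1]_u F u); first by rewrite ge0_integral_distribution.
rewrite -mu2E//; apply: eq_measure_integral => C mC _.
(* Measurable rectangles form a pi-system generating the product sigma-algebra, and on them the
   equality is the assumption on the conditional law. *)
apply: (measure_unique [set A `*` B | A in measurable & B in measurable]
  (fun=> setT)) => //=.
- exact: measurable_prod_measurableType.
- move=> _ _ [A1 mA1 [B1 mB1 <-]] [A2 mA2 [B2 mB2 <-]].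
  exists (A1 `&` A2); first exact: measurableI.
  by exists (B1 `&` B2); [exact: measurableI|rewrite setXI].
- by move=> _; exists setT => //; exists setT => //; rewrite setXTT.
- by rewrite bigcup_const//; exists 0%N.
- move=> _ [A mA [B mB <-]].
  have mAB : measurable (A `*` B : set (OmegaG * R)) by exact: measurableX.
  change (P (A `&` Y @^-1` B) = mu2 (A `*` B)).
  have [_ ->] := YP B mB; last by [].
  rewrite (_ : mu2 _ = \int[mu2]_u (\1_(A `*` B) u)%:E); last first.
    by rewrite integral_indic// setIT.
  rewrite mu2E//; last first.
    by apply/measurable_EFinP; exact: measurable_indic.
  rewrite integral_mkcond; apply: eq_integral => w _; rewrite patchE.
  have indicAB y : (\1_(A `*` B) (w, y) = \1_A w * \1_B y :> R)%R.
    by rewrite !indicE in_setX/=; case: (w \in A); rewrite ?mul1r ?mul0r.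
  case: ifPn => wA; last first.
    rewrite integral0_eq// => y _.
    by rewrite indicAB indicE (negbTE wA) mul0r mul0e.
  rewrite integral_mkcond; apply: eq_integral => y _.
  rewrite patchE indicAB !indicE wA mul1r.
  by case: ifPn; rewrite ?mul1e ?mul0e.
- by move=> _; rewrite -ge0_fin_numE ?measure_ge0// fin_num_measure.
Qed.

End conditional_density.

(** * Convexity of the exponential, null sets and exponential tilting *)

(** By convexity, with [y] the mean of [0] and [b] under weights [1 - y / b] and [y / b]. This is
    the comparison with a two-point variable in Hoeffding's lemma. *)
Lemma expR_chord (R : realType) (a b y : R) : 0 < b -> 0 <= y <= b ->
  expR (a * y) <= 1 - y / b + y / b * expR (a * b).
Proof.
move=> b0 /andP[y0 yb].
have yb01 : 0 <= y / b <= 1.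
  by rewrite divr_ge0 ?(ltW b0)//= ler_pdivrMr// mul1r.
have := convex_expR (Itv01 (andP yb01).1 (andP yb01).2) (a * b) 0.
rewrite !convRE/= expR0 mulr0 addr0 mulr1 mulrCA divfK ?gt_eqF// => le.
by rewrite [leRHS]addrC.
Qed.

Lemma pos_integral_eq0 disp (T : measurableType disp) (R : realType)
    (mu : {measure set T -> \bar R}) (D : set T) (f : T -> \bar R) :
    measurable D -> measurable_fun D f -> (forall x, D x -> (0 < f x)%E) ->
  (\int[mu]_(x in D) f x = 0 -> mu D = 0)%E.
Proof.
move=> mD mf f0 If.
have /(ae_eq_integral_abs mu mD mf)[N [mN N0 DN]] :
    (\int[mu]_(x in D) `|f x| = 0)%E.
  rewrite -[RHS]If; apply: eq_integral => x /[!inE] /f0 /ltW.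
  exact: gee0_abs.
apply: (subset_measure0 _ _ _ N0) => // x Dx; apply: DN => /= /(_ Dx) fx0.
by have := f0 x Dx; rewrite fx0 ltxx.
Qed.

(* Since the density is positive, a set that Y avoids almost surely is null for
   the reference measure itself. *)
Lemma cond_density_null_set disp (Omega : measurableType disp) (R : realType)
    (P : probability Omega R) (F : set (set Omega)) (Y : Omega -> R)
    (nu : {measure set R -> \bar R}) (q : Omega -> R -> R) (B : set R) :
    F `<=` measurable -> F setT -> has_cond_density P F Y nu q ->
    (forall w, measurable_fun setT (q w)) -> (forall w y, 0 < q w y) ->
    measurable B -> P (Y @^-1` B) = 0%E ->
  nu B = 0%E.
Proof.
move=> FP FT YP mq q0 mB PB0.
have [mK /(_ _ FT)] := YP B mB; rewrite setTI PB0 => K0.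
(* If [nu B] were nonzero, the integral of the positive [q w] over [B] would be positive for every
   [w], and the vanishing outer integral would force [P setT = 0]. *)
have [/eqP//|nuB] := eqVneq (nu B) 0%E.
have : P setT = 0%E.
  apply: (pos_integral_eq0 _ _ _ (esym K0)) => //.
    by move=> _ C mC; rewrite setTI; apply/FP/mK.
  move=> w _; rewrite lt_neqAle eq_sym integral_ge0 ?andbT//; last first.
    by move=> y _; rewrite lee_fin ltW.
  apply: contra nuB => /eqP K_eq0; apply/eqP.
  apply: (pos_integral_eq0 mB _ _ K_eq0).
    exact/measurable_EFinP/measurable_funTS.
  by move=> y _; rewrite lte_fin.
by rewrite probability_setT => /eqP; rewrite onee_eq0.
Qed.

(** Tilting an exponential family stays in the family: the factor [expR (a * y)] shifts the natural
    parameter by [a * g tau], up to a normalising constant. *)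
Lemma glm_density_tilt (R : realType) (m g : R -> R) (h : R -> R -> R)
    (tau a z y : R) : 0 < g tau ->
  expR (a * y) * glm_density m g h tau y z =
  expR ((m (z + a * g tau) - m z) / g tau) *
  glm_density m g h tau y (z + a * g tau).
Proof.
move=> g0; rewrite /glm_density -!expRD; congr expR; field.
by rewrite gt_eqF.
Qed.

(** * Mean and Hoeffding bound for the reward density *)

Section glm.
Variables (R : realType) (m mu g : R -> R) (h : R -> R -> R) (tau b : R).
Variable nu : {measure set R -> \bar R}.
Hypotheses (g_gt0 : 0 < g tau) (b_gt0 : 0 < b).
Hypothesis dm : forall z : R, is_derive z 1 m (mu z).
Hypothesis p_density : forall z : R,
  is_prob_density nu (fun y => glm_density m g h tau y z).
Hypothesis nu_supp : nu (~` `[0, b]%classic) = 0%E.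
Local Notation p z := (fun y => glm_density m g h tau y z).
Local Notation phi z a := (expR ((m (z + a * g tau) - m z) / g tau)).

(** The tilted density integrates to one, so only its normalising constant remains. *)
Lemma glm_mgf (a z : R) :
  (\int[nu]_y (expR (a * y) * p z y)%:E = (phi z a)%:E)%E.
Proof.
have [mp p0 p1] := p_density (z + a * g tau).
under eq_integral do rewrite glm_density_tilt// EFinM.
rewrite ge0_integralZl//; first by rewrite p1 mule1.
  exact/measurable_EFinP.
by move=> y _; rewrite lee_fin.
Qed.

(** Integrals are restricted to [D], where [y] is bounded and hence has a first moment; nothing is
    lost since [nu] vanishes outside. *)
Let D : set R := `[0, b]%classic.

Let mD : measurable D.
Proof. exact: measurable_itv. Qed.

Let integral_D (f : R -> R) : measurable_fun setT f -> (forall y, 0 <= f y) ->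
  (\int[nu]_(y in D) (f y)%:E = \int[nu]_y (f y)%:E)%E.
Proof.
move=> mf f0; rewrite [RHS](@ge0_negligible_integral _ _ _ _ _ (~` D))//.
- by rewrite setTD setCK.
- by apply: measurableC; exact: measurable_itv.
- exact/measurable_EFinP.
- by move=> y _; rewrite lee_fin.
Qed.

Let mp z : measurable_fun setT (p z).
Proof. by case: (p_density z). Qed.

Let p0 z y : 0 <= p z y.
Proof. exact: expR_ge0. Qed.

Let mexp_p (a z : R) : measurable_fun setT (fun y => expR (a * y) * p z y).
Proof.
by apply: measurable_funM => //; apply: measurableT_comp => //.
Qed.

Let exp_p_integrable (a z : R) :
  nu.-integrable D (EFin \o (fun y => expR (a * y) * p z y)).
Proof.
apply/integrableP; split; first exact/measurable_EFinP/measurable_funTS.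
under eq_integral do rewrite /= ger0_norm ?mulr_ge0 ?expR_ge0//.
by rewrite integral_D// ?glm_mgf ?ltry// => y; rewrite mulr_ge0 ?expR_ge0.
Qed.

Let Rintegral_exp_p (a z : R) : \int[nu]_(y in D) (expR (a * y) * p z y) = phi z a.
Proof.
by rewrite /Rintegral integral_D// ?glm_mgf// => y; rewrite mulr_ge0 ?expR_ge0.
Qed.

Let p_integrable z : nu.-integrable D (EFin \o p z).
Proof.
by apply: eq_integrable (exp_p_integrable 0 z) => // y _ /=; rewrite mul0r expR0 mul1r.
Qed.

Let yp_integrable z : nu.-integrable D (EFin \o (fun y => y * p z y)).
Proof.
apply: (@le_integrable _ _ _ _ _ mD _ (EFin \o (fun y => b * p z y))) => //.
- exact/measurable_EFinP/measurable_funTS/measurable_funM.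
- move=> y; rewrite /D/= in_itv/= => /andP[y0 yb].
  by rewrite lee_fin !normrM ler_wpM2r// !ger0_norm// ltW.
- have := integrableZl mD b (p_integrable z).
  by apply: eq_integrable => // y _ /=; rewrite EFinM.
Qed.

Let Rintegral_p z : \int[nu]_(y in D) p z y = 1.
Proof.
have := Rintegral_exp_p 0 z.
rewrite mul0r addr0 subrr mul0r expR0 => <-.
by apply: eq_Rintegral => y _; rewrite mul0r expR0 mul1r.
Qed.

Let affine_p_integrable (c z : R) :
  nu.-integrable D (EFin \o (fun y => p z y + c * (y * p z y))).
Proof.
have := integrableD mD (p_integrable z) (integrableZl mD c (yp_integrable z)).
by apply: eq_integrable => // y _ /=; rewrite -EFinM -EFinD.
Qed.

Let Rintegral_affine_p (c z : R) :
  \int[nu]_(y in D) (p z y + c * (y * p z y)) =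
  1 + c * \int[nu]_(y in D) (y * p z y).
Proof.
rewrite -(Rintegral_p z) -RintegralZl// -RintegralD//.
have := integrableZl mD c (yp_integrable z).
by apply: eq_integrable => // y _ /=; rewrite EFinM.
Qed.

(* No differentiation under the integral sign: the affine lower bound
   1 + a M <= E exp(a y) is an equality at a = 0, so both sides have the same
   derivative there. *)
Lemma glm_mean (z : R) : \int[nu]_(y in D) (y * p z y) = mu z.
Proof.
set M := Rintegral _ _ _.
have phi_ge (a : R) : 1 + a * M <= phi z a.
  rewrite -Rintegral_exp_p -Rintegral_affine_p; apply: le_Rintegral => // y _.
  by rewrite mulrA -{1}[p z y]mul1r -mulrDl ler_wpM2r// expR_ge1Dx.
pose G (a : R) := phi z a - 1 - a * M.
have dG (a : R) : is_derive a 1 G (phi z a * mu (z + a * g tau) - M).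
  have da : is_derive a 1 (fun a : R => z + a * g tau) (g tau).
    by apply: is_derive_eq; rewrite /GRing.scale/=; ring.
  have dma : is_derive a 1 (fun a : R => m (z + a * g tau))
      (mu (z + a * g tau) * g tau).
    exact: (@is_derive1_comp _ m (fun a => z + a * g tau) a _ _ (dm _) da).
  have dma' : is_derive a 1 (fun a : R => (m (z + a * g tau) - m z) / g tau)
      (mu (z + a * g tau)).
    apply: is_derive_eq; rewrite /GRing.scale/=; field.
    by rewrite gt_eqF.
  have de : is_derive a 1 (fun a : R => phi z a)
      (phi z a * mu (z + a * g tau)).
    exact: (@is_derive1_comp _ expR
      (fun a => (m (z + a * g tau) - m z) / g tau) a _ _ (is_derive_expR _) dma').
  by apply: is_derive_eq; rewrite /GRing.scale/=; ring.
have G0 : G 0 = 0.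
  by rewrite /G !mul0r addr0 subrr mul0r expR0 subrr subr0.
have dG0 : is_derive (0 : R) 1 G 0.
  (* [G] is nonnegative and vanishes at 0, an interior minimum on []-1, 1[], so its derivative
     [mu z - M] there is zero. *)
  apply: (@derive1_at_min _ G (-1) 1 0); rewrite ?in_itv/=; [lra| |lra|].
    by move=> a _; have [] := dG a.
  by move=> a _; rewrite G0 /G; have := phi_ge a; lra.
have := @derive_val _ _ _ _ _ _ _ dG0; rewrite (@derive_val _ _ _ _ _ _ _ (dG 0)).
by rewrite mul0r addr0 subrr mul0r expR0 mul1r; lra.
Qed.

(** Hoeffding's lemma: the chord bound dominates the moment generating function by that of [b] times
    a Bernoulli variable with the same mean, of parameter [mu z / b]. *)
Lemma glm_log_mgf_le (z a : R) :
  (m (z + a * g tau) - m z) / g tau <= a * mu z + a ^+ 2 * b ^+ 2 / 8.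
Proof.
have b0 := ltW b_gt0.
(* [mu z] is the mean of a variable with values in [[0, b]]. *)
have M01 : 0 <= mu z / b <= 1.
  rewrite -glm_mean divr_ge0//=; last first.
    apply: Rintegral_ge0 => y; rewrite /D/= in_itv/= => /andP[y0 _].
    by rewrite mulr_ge0.
  rewrite ler_pdivrMr// mul1r -[leRHS]mulr1 -(Rintegral_p z) -RintegralZl//.
  apply: le_Rintegral => //.
    have := integrableZl mD b (p_integrable z).
    by apply: eq_integrable => // y _ /=; rewrite EFinM.
  move=> y; rewrite /D/= in_itv/= => /andP[y0 yb].
  exact: ler_wpM2r.
have -> : a * mu z + a ^+ 2 * b ^+ 2 / 8 =
    mu z / b * (a * b) + (a * b) ^+ 2 / 8 by field; rewrite gt_eqF.
rewrite -ler_expR; apply: le_trans (bernoulli_mgf_le _ M01).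
have -> : 1 - mu z / b + mu z / b * expR (a * b) =
    1 + (expR (a * b) - 1) / b * mu z by field; rewrite gt_eqF.
rewrite -glm_mean -Rintegral_affine_p -Rintegral_exp_p.
apply: le_Rintegral => // y; rewrite /D/= in_itv/= => y0b.
rewrite mulrA -{2}[p z y]mul1r -mulrDl ler_wpM2r//.
apply: le_trans (expR_chord a b_gt0 y0b) _.
by rewrite le_eqVlt; apply/orP; left; apply/eqP; field; rewrite gt_eqF.
Qed.

(** The one-round estimate for the supermartingale: once the constant [c] is factored out, the
    logarithmic bound applies. *)
Lemma glm_hoeffding (z a : R) :
  (\int[nu]_y (expR (a * (y - mu z) - a ^+ 2 * b ^+ 2 / 8) * p z y)%:E <= 1)%E.
Proof.
pose c := expR (- (a * mu z + a ^+ 2 * b ^+ 2 / 8)).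
under eq_integral => y _.
  rewrite (_ : _ * _ = c * (expR (a * y) * p z y)); last first.
    by rewrite /c mulrA -expRD; congr (expR _ * _); ring.
  rewrite EFinM.
  over.
rewrite ge0_integralZl//.
- rewrite glm_mgf -EFinM lee_fin -expRD -[leRHS]expR0 ler_expR.
  have := glm_log_mgf_le z a; lra.
- exact/measurable_EFinP.
- by move=> y _; rewrite lee_fin mulr_ge0 ?expR_ge0.
- by rewrite lee_fin expR_ge0.
Qed.

End glm.

(** * Euclidean geometry and the discounted drift *)

Lemma norm2_ge0 (R : realType) (d : nat) (u : 'rV[R]_d) : 0 <= norm2 u.
Proof. exact: sqrtr_ge0. Qed.

Lemma norm2_sq (R : realType) (d : nat) (u : 'rV[R]_d) :
  norm2 u ^+ 2 = \sum_(i < d) u 0 i ^+ 2.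
Proof. by rewrite sqr_sqrtr// sumr_ge0// => i _; exact: sqr_ge0. Qed.

Lemma dotBr (R : realType) (d : nat) (u v w : 'rV[R]_d) :
  dot u (v - w) = dot u v - dot u w.
Proof. by rewrite /dot -sumrB; apply: eq_bigr => i _; rewrite !mxE mulrBr. Qed.

(** Lagrange's identity: twice the gap is the double sum of the squares of
    [u 0 i * v 0 j - u 0 j * v 0 i]. *)
Lemma dot_sq_le (R : realType) (d : nat) (u v : 'rV[R]_d) :
  dot u v ^+ 2 <= (\sum_(i < d) u 0 i ^+ 2) * (\sum_(i < d) v 0 i ^+ 2).
Proof.
set A := \sum_(i < d) _; set B := \sum_(i < d) _.
suff : 0 <= A * B + B * A - 2 * dot u v ^+ 2 by lra.
rewrite expr2 mulr_natl mulr2n opprD addrACA /dot !big_distrlr/= -!sumrB -big_split.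
apply: sumr_ge0 => i _ /=; rewrite -!sumrB -big_split.
apply: sumr_ge0 => j _ /=.
rewrite (_ : _ + _ = (u 0 i * v 0 j - u 0 j * v 0 i) ^+ 2) ?sqr_ge0//; ring.
Qed.

Lemma normr_dot_le (R : realType) (d : nat) (u v : 'rV[R]_d) :
  `|dot u v| <= norm2 u * norm2 v.
Proof.
rewrite -(ler_pXn2r (isT : (0 < 2)%N)) ?nnegrE ?mulr_ge0 ?norm2_ge0//.
by rewrite real_normK ?num_real// exprMn !norm2_sq dot_sq_le.
Qed.

Lemma norm2D (R : realType) (d : nat) (u v : 'rV[R]_d) :
  norm2 (u + v) <= norm2 u + norm2 v.
Proof.
rewrite -(ler_pXn2r (isT : (0 < 2)%N)) ?nnegrE ?addr_ge0 ?norm2_ge0//.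
have uv := le_trans (ler_norm _) (normr_dot_le u v).
have -> : norm2 (u + v) ^+ 2 = norm2 u ^+ 2 + 2 * dot u v + norm2 v ^+ 2.
  rewrite !norm2_sq /dot mulr_sumr -!big_split/=.
  by apply: eq_bigr => i _; rewrite !mxE; ring.
rewrite sqrrD mulr_natl; lra.
Qed.

Lemma norm2_telescope (R : realType) (d : nat) (v : nat -> 'rV[R]_d) (s t : nat) :
  (s <= t)%N ->
  norm2 (v t - v s) <= \sum_(s <= p < t) norm2 (v p.+1 - v p).
Proof.
elim: t => [|t IH].
  rewrite leqn0 => /eqP ->; rewrite big_geq// subrr /norm2 big1 ?sqrtr0// => i _.
  by rewrite mxE expr0n.
rewrite leq_eqVlt ltnS => /predU1P[->|st].
  rewrite big_geq// subrr /norm2 big1 ?sqrtr0// => i _.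
  by rewrite mxE expr0n.
rewrite big_nat_recr//= -(subrKA (v t)) addrC [leRHS]addrC.
by apply: le_trans (norm2D _ _) _; rewrite addrC lerD// IH.
Qed.

(* Expanding both squares, the coefficient of a_p a_q on the left is the total
   weight up to min(p, q), which is at most the geometric mean of the total
   weights up to p and up to q. *)
Lemma weighted_tail_sum_sq_le (R : realType) (w a : nat -> R) (t : nat) :
    (forall s, 0 <= w s) -> (forall p, 0 <= a p) ->
  \sum_(1 <= s < t) w s * (\sum_(s <= p < t) a p) ^+ 2 <=
  (\sum_(1 <= p < t) Num.sqrt (\sum_(1 <= s < p.+1) w s) * a p) ^+ 2.
Proof.
move=> w0 a0; pose W p := \sum_(1 <= s < p.+1) w s.
have W_ge0 p : 0 <= W p by apply: sumr_ge0.
have W_mono p q : (p <= q)%N -> W p <= W q.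
  by move=> pq; rewrite /W [leRHS](@big_cat_nat _ _ _ p.+1)//= lerDl sumr_ge0.
(* This indicator makes all summation ranges rectangular, so that the sums can be exchanged. *)
pose c (s p : nat) : R := (s <= p)%:R.
have tailE s : (1 <= s)%N -> \sum_(s <= p < t) a p = \sum_(1 <= p < t) c s p * a p.
  move=> s1; rewrite (@big_nat_widenl _ _ _ _ 1)// [LHS]big_mkcond/=.
  by apply: eq_bigr => p _; rewrite /c; case: (s <= p)%N; rewrite ?mul1r ?mul0r.
have headE p : (p < t)%N -> \sum_(1 <= s < t) w s * c s p = W p.
  move=> pt; rewrite /W (@big_nat_widen _ _ _ 1 p.+1 t)//= [RHS]big_mkcond/=.
  apply: eq_bigr => s _; rewrite /c ltnS.
  by case: (s <= p)%N; rewrite ?mulr1 ?mulr0.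
have headI p q : (p <= q < t)%N ->
    \sum_(1 <= s < t) w s * (c s p * c s q) <= Num.sqrt (W p) * Num.sqrt (W q).
  move=> /andP[pq qt].
  have -> : \sum_(1 <= s < t) w s * (c s p * c s q) = W p.
    rewrite -headE ?(leq_ltn_trans pq)//; apply: eq_bigr => s _; congr (_ * _).
    rewrite /c; have [sp|_] := leqP s p; last by rewrite mul0r.
    by rewrite (leq_trans sp pq) mulr1.
  rewrite -[leLHS]sqr_sqrtr// expr2 ler_wpM2l ?sqrtr_ge0//.
  by rewrite ler_wsqrtr// W_mono.
(* For [p <= q] the condition [s <= p] implies [s <= q]. *)
have -> : \sum_(1 <= s < t) w s * (\sum_(s <= p < t) a p) ^+ 2 =
    \sum_(1 <= p < t) \sum_(1 <= q < t)
      (\sum_(1 <= s < t) w s * (c s p * c s q)) * (a p * a q).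
  transitivity (\sum_(1 <= s < t) \sum_(1 <= p < t) \sum_(1 <= q < t)
      w s * (c s p * c s q) * (a p * a q)).
    apply: eq_big_nat => s /andP[s1 _].
    rewrite tailE// expr2 big_distrlr/= mulr_sumr; apply: eq_bigr => p _.
    by rewrite mulr_sumr; apply: eq_bigr => q _; ring.
  rewrite exchange_big/=; apply: eq_bigr => p _.
  rewrite exchange_big/=; apply: eq_bigr => q _.
  by rewrite mulr_suml.
rewrite expr2 big_distrlr/=.
rewrite big_nat [leRHS]big_nat; apply: ler_sum => p /andP[_ pt].
rewrite big_nat [leRHS]big_nat; apply: ler_sum => q /andP[_ qt].
rewrite mulrACA ler_wpM2r ?mulr_ge0//.
have [pq|/ltnW qp] := leqP p q; first by rewrite headI ?pq.
rewrite mulrC; under eq_bigr do rewrite [c _ p * _]mulrC.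
by rewrite headI ?qp.
Qed.

(** The total weights up to [p], whose square roots are the coefficients of
    [discounted_variation]. *)
Lemma sum_geometric_weights (R : realType) (gamma : R) (t p : nat) :
    gamma != 1 -> (p < t)%N ->
  \sum_(1 <= s < p.+1) gamma ^+ (t - 1 - s) =
  gamma ^+ (t - 1 - p) * ((1 - gamma ^+ p) / (1 - gamma)).
Proof.
move=> g1; elim: p => [|p IH] pt.
  by rewrite big_geq// expr0 subrr mul0r mulr0.
rewrite big_nat_recr//= IH ?(ltn_trans _ pt)//.
(* The bound [p.+1 < t] prevents truncation of the natural subtraction. *)
have -> : (t - 1 - p = (t - 1 - p.+1).+1)%N by lia.
rewrite !exprS; field; lra.
Qed.

Lemma sqrt_exprM_powR (R : realType) (gamma c : R) (k : nat) : 0 < gamma ->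
  Num.sqrt (gamma ^+ k * c) = gamma `^ (k%:R / 2) * Num.sqrt c.
Proof.
move=> g0; rewrite sqrtrM ?exprn_ge0 ?(ltW g0)//.
by rewrite -powR12_sqrt ?exprn_ge0 ?(ltW g0)// -powR_mulrn ?(ltW g0)// -powRrM.
Qed.

Lemma discounted_drift_le (R : realType) (d : nat) (gamma : R)
    (x theta : nat -> 'rV[R]_d) (t : nat) : 0 < gamma < 1 ->
    (forall s, (1 <= s)%N -> norm2 (x s) <= 1) ->
  \sum_(1 <= s < t) gamma ^+ (t - 1 - s) * dot (x s) (theta t - theta s) ^+ 2 <=
  discounted_variation gamma theta t ^+ 2.
Proof.
move=> /andP[g0 g1] x1.
pose w s := gamma ^+ (t - 1 - s); pose a p := norm2 (theta p.+1 - theta p).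
have w0 s : 0 <= w s by rewrite exprn_ge0// ltW.
have a0 p : 0 <= a p by exact: norm2_ge0.
have -> : discounted_variation gamma theta t =
    \sum_(1 <= p < t) Num.sqrt (\sum_(1 <= s < p.+1) w s) * a p.
  apply: eq_big_nat => p /andP[_ pt].
  by rewrite sum_geometric_weights ?sqrt_exprM_powR// lt_eqF.
apply: le_trans (weighted_tail_sum_sq_le t w0 a0).
rewrite big_nat [leRHS]big_nat; apply: ler_sum => s /andP[s1 st].
apply: ler_wpM2l; first exact: (w0 s).
rewrite -real_normK ?num_real//.
rewrite ler_pXn2r ?nnegrE ?sumr_ge0//.
apply: le_trans (normr_dot_le _ _) _.
apply: le_trans (norm2_telescope theta (ltnW st)).
by rewrite ler_piMl ?norm2_ge0 ?x1.
Qed.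

(** * Measurability of inner products and norms *)

Lemma measurable_dot (R : realType) disp (T : measurableType disp) (d : nat)
    (u v : T -> 'rV[R]_d) : random_vector u -> random_vector v ->
  measurable_fun setT (fun w => dot (u w) (v w)).
Proof.
by move=> mu mv; apply: measurable_sum => i; apply: measurable_funM.
Qed.

Lemma random_vectorB (R : realType) disp (T : measurableType disp) (d : nat)
    (u v : T -> 'rV[R]_d) : random_vector u -> random_vector v ->
  random_vector (fun w => u w - v w).
Proof.
move=> mu mv i; under eq_fun do rewrite !mxE.
exact: measurable_funB.
Qed.

Lemma measurable_norm2 (R : realType) disp (T : measurableType disp) (d : nat)
    (u : T -> 'rV[R]_d) : random_vector u ->
  measurable_fun setT (fun w => norm2 (u w)).
Proof.
move=> mu.
apply: (measurableT_comp (continuous_measurable_fun (@sqrt_continuous R))).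
by apply: measurable_sum => i; apply: measurable_funX.
Qed.

(** * The history sigma-algebra *)

Section history.
Variables (R : realType) (disp : measure_display) (Omega : measurableType disp).
Variables (d : nat) (x theta : nat -> Omega -> 'rV[R]_d) (r : nat -> Omega -> R).

(** The family generating [history], named so that [Omega] with the history sigma-algebra becomes a
    measurable type. *)
Definition history_generator (t : nat) : set (set Omega) :=
  (\bigcup_(s in [set s | (1 <= s <= t)%N]) sigma_vec (x s)) `|`
  (\bigcup_(s in [set s | (1 <= s < t)%N]) g_sigma_algebra_preimage (r s)) `|`
  (\bigcup_(s in [set s | (1 <= s)%N]) sigma_vec (theta s)).

Local Notation OmegaH t := (g_sigma_algebraType (history_generator t)).

Lemma sub_sigma_vec (v : Omega -> 'rV[R]_d) (G : set (set Omega)) :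
  sigma_vec v `<=` G -> random_vector (v : g_sigma_algebraType G -> _).
Proof.
move=> vG i _ B mB; rewrite setTI; apply: sub_sigma_algebra; apply: vG.
apply: sub_sigma_algebra; exists i => //.
by exists B => //; rewrite setTI.
Qed.

Lemma history_x (s t : nat) : (1 <= s <= t)%N ->
  random_vector (x s : OmegaH t -> _).
Proof. by move=> st; apply: sub_sigma_vec => A xA; left; left; exists s. Qed.

(** There is no upper bound on [s]: every history contains the whole parameter sequence, which keeps
    coefficients involving later parameters predictable. *)
Lemma history_theta (s t : nat) : (1 <= s)%N ->
  random_vector (theta s : OmegaH t -> _).
Proof. by move=> s1; apply: sub_sigma_vec => A xA; right; exists s. Qed.

Lemma history_r (s t : nat) : (1 <= s < t)%N ->
  measurable_fun setT (r s : OmegaH t -> R).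
Proof.
move=> st _ B mB; rewrite setTI; apply: sub_sigma_algebra; left; right.
by exists s => //; exists B => //; rewrite setTI.
Qed.

Lemma sigma_vec_measurable (v : Omega -> 'rV[R]_d) :
  random_vector v -> sigma_vec v `<=` measurable.
Proof.
move=> mv; apply: smallest_sub; first exact: sigma_algebra_measurable.
by move=> _ [i _ [B mB <-]]; exact: mv.
Qed.

Lemma history_measurable (t : nat) :
    (forall s, (1 <= s)%N -> random_vector (x s)) ->
    (forall s, (1 <= s)%N -> random_vector (theta s)) ->
    (forall s, measurable_fun setT (r s)) ->
  history x theta r t `<=` measurable.
Proof.
move=> mx mth mr; apply: smallest_sub; first exact: sigma_algebra_measurable.
move=> A [[[s /andP[s1 _]]|[s _ [B mB <-]]]|[s s1]].
- exact/sigma_vec_measurable/mx.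
- exact: mr.
- exact/sigma_vec_measurable/mth.
Qed.

End history.

(** * The exponential supermartingale *)

Section exponential_supermartingale.
Variables (R : realType) (disp : measure_display) (Omega : measurableType disp).
Variables (P : probability Omega R) (d : nat).
Variables (m mu g : R -> R) (h : R -> R -> R) (tau b : R).
Variables (nu : {measure set R -> \bar R}) (x theta : nat -> Omega -> 'rV[R]_d).
Variable r : nat -> {RV P >-> R}.
Hypotheses (g_gt0 : 0 < g tau) (b_gt0 : 0 < b).
Hypothesis dm : forall z : R, is_derive z 1 m (mu z).
Hypothesis mmu : measurable_fun setT mu.
Hypothesis p_density : forall z : R,
  is_prob_density nu (fun y => glm_density m g h tau y z).
Hypothesis nu_supp : nu (~` `[0, b]%classic) = 0%E.
Hypothesis x_rv : forall t, (1 <= t)%N -> random_vector (x t).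
Hypothesis theta_rv : forall t, (1 <= t)%N -> random_vector (theta t).
Hypothesis r_law : forall t, (1 <= t)%N ->
  has_cond_density P (history x theta r t) (r t) nu
    (fun w y => glm_density m g h tau y (dot (x t w) (theta t w))).

Local Notation OmegaH t := (g_sigma_algebraType (history_generator x theta r t)).

(** Induction on the number of rounds: given the history of the last round, the earlier factors are
    fixed and the last one has conditional expectation at most 1. *)
Lemma exponential_supermartingale (a : nat -> Omega -> R) (n : nat) :
    (forall s t, (1 <= s <= t)%N -> measurable_fun setT (a s : OmegaH t -> R)) ->
  (\int[P]_w (expR (\sum_(1 <= s < n)
     (a s w * (r s w - mu (dot (x s w) (theta s w)))
      - a s w ^+ 2 * b ^+ 2 / 8)))%:E <= 1)%E.
Proof.
move=> ma; pose z s w := dot (x s w) (theta s w).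
pose e s w y := a s w * (y - mu (z s w)) - a s w ^+ 2 * b ^+ 2 / 8.
have mz s t : (1 <= s <= t)%N -> measurable_fun setT (z s : OmegaH t -> R).
  move=> st; apply: measurable_dot; first exact: history_x.
  by apply: history_theta; case/andP: st.
have mm : measurable_fun setT m.
  apply: continuous_measurable_fun => u.
  by apply/differentiable_continuous/derivable1_diffP; have [] := dm u.
(* The range [1 <= s < n] is empty for both [n = 0] and [n = 1]; after this split each induction
   step adds round [n.+1]. *)
case: n => [|n].
  under eq_integral do rewrite big_geq// expR0.
  by rewrite integral_cst// mul1e probability_le1.
elim: n => [|n IH].
  under eq_integral do rewrite big_geq// expR0.
  by rewrite integral_cst// mul1e probability_le1.
pose U w := expR (\sum_(1 <= s < n.+1) e s w (r s w)).
apply: le_trans IH.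
pose F (u : OmegaH n.+1 * R) := (U u.1 * expR (e n.+1 u.1 u.2))%:E.
(* The ratio of the density at parameter [z] to the density at parameter 0. The term [h] cancels, so
   joint measurability is plain. *)
pose k (u : OmegaH n.+1 * R) :=
  expR ((u.2 * z n.+1 u.1 - m (z n.+1 u.1) + m 0) / g tau).
have kE w y : k (w, y) * glm_density m g h tau y 0 =
    glm_density m g h tau y (z n.+1 w).
  rewrite /k /glm_density -expRD /=; congr expR; field.
  by rewrite gt_eqF.
have me (disp' : measure_display) (T : measurableType disp') s
    (v : T -> OmegaH n.+1) (y : T -> R) :
    (1 <= s <= n.+1)%N -> measurable_fun setT v -> measurable_fun setT y ->
    measurable_fun setT (fun u => e s (v u) (y u)).
  move=> sn mv my.
  have mav := measurableT_comp (ma s n.+1 sn) mv.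
  have mzv := measurableT_comp (mz s n.+1 sn) mv.
  apply: measurable_funB.
    apply: measurable_funM => //; apply: measurable_funB => //.
    exact: measurableT_comp mzv.
  do 2 apply: measurable_funM => //.
  exact: measurable_funX.
(* [U] involves rewards up to round [n] only, all of which belong to the history of round [n.+1]. *)
have mU : measurable_fun setT (U : OmegaH n.+1 -> R).
  have -> : U = expR \o (fun w => \sum_(s < n) e s.+1 w (r s.+1 w)).
    by apply/funext => w; rewrite /U/= big_add1 big_mkord.
  apply: measurableT_comp => //.
  apply: measurable_sum => s; apply: (me _ (OmegaH n.+1) s.+1 id (r s.+1)) => //.
    exact: leq_trans (ltn_ord s) _.
  by apply: history_r; rewrite /= ltnS ltn_ord.
have mF : measurable_fun setT F.
  apply/measurable_EFinP/measurable_funM; first exact: measurableT_comp.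
  apply: measurableT_comp => //.
  exact: (me _ (OmegaH n.+1 * R)%type n.+1 fst snd (leqnn _)).
have mk : measurable_fun setT k.
  have mz1 := measurableT_comp (mz n.+1 n.+1 (leqnn _)) measurable_fst.
  apply: measurableT_comp => //; apply: measurable_funM => //.
  apply: measurable_funD => //; apply: measurable_funB => //.
    by apply: measurable_funM => //; exact: mz1.
  by apply: (measurableT_comp mm); exact: mz1.
have r_density : has_cond_density P <<s history_generator x theta r n.+1>>
    (r n.+1) nu (fun w y => k (w, y) * glm_density m g h tau y 0).
  rewrite (_ : (fun w y => _) = fun w y => glm_density m g h tau y (z n.+1 w)).
    exact: r_law.
  by apply/funext => w; apply/funext => y; rewrite kE.
have histP : <<s history_generator x theta r n.+1>> `<=` measurable.
  exact: history_measurable.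
have F0 u : (0 <= F u)%E by rewrite lee_fin mulr_ge0 ?expR_ge0.
have := @ge0_integral_cond_density _ _ _ P _ nu _ k histP (p_density 0) mk
  (fun u => expR_ge0 _) (r n.+1) F r_density mF F0.
case=> mK; under eq_integral do rewrite /F /= -expRD -big_nat_recr//=.
move=> ->; apply: ge0_le_integral => //.
- move=> w _; apply: integral_ge0 => y _.
  by apply: mule_ge0 => //; rewrite lee_fin kE expR_ge0.
- apply/measurable_EFinP; apply: (measurableT_comp (f := U : OmegaH n.+1 -> R)).
    exact: mU.
  by move=> _ A mA; rewrite setTI; exact: histP.
(* For fixed [w] the past factor [U w] is a constant of the inner integral. *)
move=> w _; rewrite -[leRHS]mule1.
rewrite (_ : integral _ _ _ = \int[nu]_y ((U w)%:E *
    (expR (e n.+1 w y) * glm_density m g h tau y (z n.+1 w))%:E))%E; last first.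
  by apply: eq_integral => y _; rewrite /F/= kE -!EFinM mulrA.
have [mp p0 _] := p_density (z n.+1 w).
rewrite ge0_integralZl//.
- apply: lee_wpmul2l; first by rewrite lee_fin expR_ge0.
  exact: (@glm_hoeffding _ _ mu _ _ _ b).
- apply/measurable_EFinP/measurable_funM => //.
  apply: measurableT_comp => //; apply: measurable_funB => //.
  by apply: measurable_funM => //; apply: measurable_funB.
- by move=> y _; rewrite lee_fin mulr_ge0 ?expR_ge0.
- by rewrite lee_fin expR_ge0.
Qed.

End exponential_supermartingale.

(** * Markov's inequality and the one-round loss increment *)

(** Outside [A] one has [expR (W w) >= delta^-1], an event of probability at most [delta] by
    Markov's inequality. *)
Lemma exponential_tail (R : realType) disp (Omega : measurableType disp)
    (P : probability Omega R) (W : Omega -> R) (delta : R) (A : set Omega) :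
    measurable_fun setT W -> (\int[P]_w (expR (W w))%:E <= 1)%E -> 0 < delta ->
    measurable A -> [set w | W w <= ln (1 / delta)] `<=` A ->
  ((1 - delta)%:E <= P A)%E.
Proof.
move=> mW EW d0 mA WA.
have meW : measurable_fun setT (fun w => (expR (W w))%:E).
  by apply/measurable_EFinP; exact: measurableT_comp.
have d0' : 0 < delta^-1 by rewrite invr_gt0.
have PCA : (P (~` A) <= delta%:E)%E.
  have := le_integral_abse P measurableT meW d0'.
  set B := _ `&` _ => le1.
  have mB : measurable B.
    have mabs : measurable_fun setT (fun w => `|(expR (W w))%:E|%E).
      exact: measurableT_comp.
    exact: (emeasurable_fun_c_infty measurableT mabs).
  have PB : (P B <= delta%:E)%E.
    have : ((delta^-1)%:E * P B <= 1)%E.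
      apply: le_trans le1 _; under eq_integral do rewrite gee0_abs ?lee_fin ?expR_ge0//.
      exact: EW.
    by rewrite lee_pdivrMl// mule1.
  apply: le_trans PB; apply: le_measure; rewrite ?inE//; first exact: measurableC.
  move=> w Aw; split => //=; rewrite lee_fin ger0_norm ?expR_ge0//.
  rewrite leNgt; apply/negP => Ww; apply: Aw; apply: WA => /=.
  rewrite -ler_expR lnK ?posrE ?divr_gt0// div1r.
  exact: ltW.
by rewrite -[A]setCK probability_setC ?EFinB ?leeB//; exact: measurableC.
Qed.

Lemma measurable_le_set (R : realType) disp (T : measurableType disp)
    (f f' : T -> R) : measurable_fun setT f -> measurable_fun setT f' ->
  measurable [set w | f w <= f' w].
Proof.
move=> mf mf'; rewrite (_ : [set w | _] = (fun w => f w <= f' w) @^-1` [set true]).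
  by rewrite -[X in measurable X]setTI; exact: measurable_fun_ler.
by apply/seteqP; split.
Qed.

Lemma measurable_sum_nat (R : realType) disp (T : measurableType disp)
    (f : nat -> T -> R) (n : nat) :
    (forall s, (1 <= s)%N -> measurable_fun setT (f s)) ->
  measurable_fun setT (fun w => \sum_(1 <= s < n) f s w).
Proof.
move=> mf; rewrite (_ : (fun w => _) = fun w => \sum_(s < n.-1) f s.+1 w).
  by apply: measurable_sum => s; exact: mf.
by apply/funext => w; rewrite big_add1 big_mkord.
Qed.

(** Here [gamma] stands for the whole weight of a round. The choice of [a] makes the linear term
    reproduce the noise exactly; the Taylor remainder and the quadratic compensator each cost at
    most half of the drift term. *)
Lemma loss_increment_le (R : realType) (d : nat) (m mu mu' g : R -> R)
    (tau b S k gamma : R) (x u v : 'rV[R]_d) (r : R) :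
    0 < g tau -> 0 < b -> 0 < k -> 0 <= gamma <= 1 ->
    (forall z : R, is_derive z 1 m (mu z)) ->
    (forall z : R, is_derive z 1 mu (mu' z)) ->
    (forall z, - S <= z <= S -> mu' z <= k) ->
    `|dot x u| <= S -> `|dot x v| <= S ->
  let a := - (4 * k / b ^+ 2 * gamma * dot x (u - v)) in
  gamma * (loss m g tau x r u - loss m g tau x r v) <=
  k / g tau * (gamma * dot x (u - v) ^+ 2) +
  b ^+ 2 / (4 * g tau * k) * (a * (r - mu (dot x v)) - a ^+ 2 * b ^+ 2 / 8).
Proof.
move=> g0 b0 k0 /andP[c0 c1] dm dmu muk xu xv /=.
have taylor : m (dot x u) - m (dot x v) - mu (dot x v) * (dot x u - dot x v) <=
    k / 2 * (dot x u - dot x v) ^+ 2.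
  apply: taylor2_upper_bound dm dmu _ => l /andP[l0 l1]; apply: muk.
  move: xu xv; rewrite !ler_norml => /andP[u1 u2] /andP[v1 v2].
  (* The interval [[- S, S]] is convex, so it contains the segment between the two inner
     products. *)
  by apply/andP; split; nra.
rewrite dotBr /loss.
set y := dot x u in taylor *; set z := dot x v in taylor *.
have -> : b ^+ 2 / (4 * g tau * k) *
    (- (4 * k / b ^+ 2 * gamma * (y - z)) * (r - mu z) -
     (- (4 * k / b ^+ 2 * gamma * (y - z))) ^+ 2 * b ^+ 2 / 8) =
    (- (gamma * (y - z) * (r - mu z)) - k / 2 * gamma ^+ 2 * (y - z) ^+ 2) / g tau.
  by field; rewrite !gt_eqF.
have -> : gamma * ((m y - r * y) / g tau - (m z - r * z) / g tau) =
    (gamma * (m y - m z - mu z * (y - z)) - gamma * (y - z) * (r - mu z)) / g tau.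
  by field; rewrite gt_eqF.
rewrite (mulrAC k) -mulrDl ler_pM2r ?invr_gt0//.
have h1 := ler_wpM2l c0 taylor.
(* The slack left by [gamma ^+ 2 <= gamma]. *)
have h2 : 0 <= k / 2 * (gamma * (1 - gamma)) * (y - z) ^+ 2.
  by rewrite mulr_ge0 ?sqr_ge0// !mulr_ge0 ?subr_ge0// ltW.
rewrite !expr2 in h1 h2 *; lra.
Qed.

Lemma measurable_discounted_variation (R : realType) disp
    (T : measurableType disp) (d : nat) (gamma : R)
    (theta : nat -> T -> 'rV[R]_d) (t : nat) :
    (forall s, (1 <= s)%N -> random_vector (theta s)) ->
  measurable_fun setT (fun w => discounted_variation gamma (fun s => theta s w) t).
Proof.
move=> mtheta; apply: measurable_sum_nat => s s1.
apply: measurable_funM => //; apply: measurable_norm2.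
by apply: random_vectorB; exact: mtheta.
Qed.

Lemma measurable_loss (R : realType) disp (T : measurableType disp) (d : nat)
    (m g : R -> R) (tau : R) (x u : T -> 'rV[R]_d) (r : T -> R) :
    measurable_fun setT m -> random_vector x -> random_vector u ->
    measurable_fun setT r ->
  measurable_fun setT (fun w => loss m g tau (x w) (r w) (u w)).
Proof.
move=> mm mx mu mr; have mxu := measurable_dot mx mu.
apply: measurable_funM => //; apply: measurable_funB.
  exact: measurableT_comp.
exact: measurable_funM.
Qed.

(** * Assembly of the high-probability bound *)

Theorem lemmaA4 (R : realType) (disp : measure_display)
    (Omega : measurableType disp) (P : probability Omega R)
    (d : nat) (d_ge1 : (1 <= d)%N)
    (Rmax Smax : R) (Rmax_gt0 : 0 < Rmax) (Smax_gt0 : 0 < Smax)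
    (m g : R -> R) (h : R -> R -> R) (tau : R)
    (nu : {measure set R -> \bar R})
    (m_convex : convex_function [set: R^o] m)
    (m_C3 : contdiff 3 m)
    (g_gt0 : 0 < g tau)
    (p_density : forall z : R,
       is_prob_density nu (fun y => glm_density m g h tau y z))
    (X : nat -> Omega -> set 'rV[R]_d)
    (x theta : nat -> Omega -> 'rV[R]_d)
    (r : nat -> {RV P >-> R})
    (x_rv : forall t, (1 <= t)%N -> random_vector (x t))
    (theta_rv : forall t, (1 <= t)%N -> random_vector (theta t))
    (x_in_X : forall t, (1 <= t)%N -> forall w, X t w (x t w))
    (r_law : forall t, (1 <= t)%N ->
       has_cond_density P (history x theta r t) (r t) nu
         (fun w y => glm_density m g h tau y (dot (x t w) (theta t w))))
    (theta_bound : forall t, (1 <= t)%N ->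
       forall w, norm2 (theta t w) <= Smax)
    (X_bound : forall t, (1 <= t)%N ->
       forall w v, X t w v -> norm2 v <= 1)
    (r_bound : forall t, (1 <= t)%N ->
       {ae P, forall w, 0 <= r t w <= Rmax})
    (c_mu k_mu : R) (c_mu_gt0 : 0 < c_mu) (k_mu_gt0 : 0 < k_mu)
    (mu_deriv_bound : forall z : R, - Smax <= z <= Smax ->
       c_mu <= derive1 (mean_function m) z <= k_mu)
    (gamma delta : R) (gamma_01 : 0 < gamma < 1) (delta_01 : 0 < delta < 1)
    (t : nat) (t_ge2 : (2 <= t)%N) :
  ((1 - delta)%:E <=
   P [set w |
        (\sum_(1 <= s < t)
           gamma ^+ (t - 1 - s) *
           (loss m g tau (x s w) (r s w) (theta t w)
            - loss m g tau (x s w) (r s w) (theta s w))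
        <= k_mu / g tau * discounted_variation gamma (fun s => theta s w) t ^+ 2
           + Rmax ^+ 2 / (4 * g tau * k_mu) * ln (1 / delta))%R])%E.
Proof.
pose mu : R -> R := derive1 m.
have [m_der mc3] := m_C3.
have dm (z : R) : is_derive z 1 m (mu z).
  by rewrite /mu derive1E; apply/derivableP; exact: (m_der 0%N).
have dmu (z : R) : is_derive z 1 mu (derive1 mu z).
  by rewrite derive1E; apply/derivableP; exact: (m_der 1%N).
have derive_measurable (f f' : R -> R) :
    (forall z : R, is_derive z 1 f (f' z)) -> measurable_fun setT f.
  move=> df; apply: continuous_measurable_fun => z.
  by apply/differentiable_continuous/derivable1_diffP; have [] := df z.
have mm := derive_measurable _ _ dm.
have mmu := derive_measurable _ _ dmu.
have t_ge1 : (1 <= t)%N := ltnW t_ge2.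
have x1 s w : (1 <= s)%N -> norm2 (x s w) <= 1.
  by move=> s1; exact: (X_bound s s1 w _ (x_in_X s s1 w)).
have dot_le s s' w : (1 <= s)%N -> (1 <= s')%N -> `|dot (x s w) (theta s' w)| <= Smax.
  move=> s1 s'1; apply: le_trans (normr_dot_le _ _) _.
  by rewrite -[Smax]mul1r ler_pM ?norm2_ge0 ?x1 ?theta_bound.
(* The reference measure is common to all rounds, so the almost sure bound on the first reward
   settles its support. *)
have nu_supp : nu (~` `[0, Rmax]%classic) = 0%E.
  apply: (@cond_density_null_set _ _ _ P _ _ nu _ _ _ _ (r_law 1%N isT)).
  - exact: history_measurable.
  - exact: (@measurableT _ (g_sigma_algebraType (history_generator x theta r 1))).
  - by move=> w; have [] := p_density (dot (x 1%N w) (theta 1%N w)).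
  - by move=> w y; exact: expR_gt0.
  - by apply: measurableC; exact: measurable_itv.
  - have [N [mN N0 rN]] := r_bound 1%N isT.
    apply: (subset_measure0 _ mN _ N0).
      rewrite -[X in measurable X]setTI; apply: measurable_funP => //.
      by apply: measurableC; exact: measurable_itv.
    by move=> w /= rw; apply: rN => /= rw'; apply: rw; rewrite /= in_itv.
have /andP[gamma0 gamma1] := gamma_01; have /andP[delta0 delta1] := delta_01.
pose c s := gamma ^+ (t - 1 - s).
have c01 s : 0 <= c s <= 1.
  by rewrite exprn_ge0 ?(ltW gamma0)// exprn_ile1 // ltW.
pose a s w := - (4 * k_mu / Rmax ^+ 2 * c s *
  dot (x s w) (theta t w - theta s w)).
pose W w := \sum_(1 <= s < t)
  (a s w * (r s w - mu (dot (x s w) (theta s w))) - a s w ^+ 2 * Rmax ^+ 2 / 8).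
apply: (@exponential_tail _ _ _ _ W) => //.
- apply: measurable_sum_nat => s s1.
  have ma : measurable_fun setT (a s).
    apply: measurableT_comp => //; apply: measurable_funM => //.
    by apply: measurable_dot; [exact: x_rv|apply: random_vectorB; exact: theta_rv].
  apply: measurable_funB.
    apply: measurable_funM => //; apply: measurable_funB => //.
    apply: measurableT_comp => //.
    by apply: measurable_dot; [exact: x_rv|exact: theta_rv].
  by do 2 apply: measurable_funM => //; exact: measurable_funX.
- apply: (@exponential_supermartingale _ _ _ P _ m mu g h tau Rmax nu) => //.
  (* Predictability of [a s]: [x s] is known from round [s] on, while [theta t] and [theta s] lie in
     every history. *)
  move=> s n /andP[s1 sn].
  apply: measurableT_comp => //; apply: measurable_funM => //.
  apply: measurable_dot; first by apply: history_x; rewrite s1.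
  by apply: random_vectorB; exact: history_theta.
- apply: measurable_le_set.
    apply: measurable_sum_nat => s s1; apply: measurable_funM => //.
    by apply: measurable_funB; apply: measurable_loss => //;
      do ?[exact: x_rv|exact: theta_rv].
  apply: measurable_funD => //; apply: measurable_funM => //.
  by apply: measurable_funX; exact: measurable_discounted_variation.
move=> w /= Ww.
have drift := @discounted_drift_le _ _ gamma (x^~ w) (theta^~ w) t
  gamma_01 (fun s => x1 s w).
have kg : 0 <= k_mu / g tau by rewrite divr_ge0// ltW.
have Rg : 0 <= Rmax ^+ 2 / (4 * g tau * k_mu).
  by rewrite divr_ge0 ?sqr_ge0// !mulr_ge0// ltW.
(* With the drift and [W] back in place of their bounds, the inequality is proved round by round. *)
apply: le_trans (lerD (ler_wpM2l kg drift) (ler_wpM2l Rg Ww)).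
rewrite !mulr_sumr -big_split big_nat [leRHS]big_nat.
apply: ler_sum => s /andP[s1 st] /=.
apply: (@loss_increment_le _ _ m mu (derive1 mu) g tau Rmax Smax k_mu) => //.
- exact: c01.
- by move=> z /mu_deriv_bound /andP[].
- exact: dot_le.
- exact: dot_le.
Qed.
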